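(* Let $n\in\mathbb N$. The real algebra $\bigotimes C^{n+1}$ is the direct sum of $2^n$ algebras isomorphic to the complex field $\mathbb C$; it is polynomial and semisimple.
   Context: $\bigotimes C^{n+1}=C_0\otimes C_1\otimes\cdots\otimes C_n$ is the tensor product over $\mathbb R$ (called ''direct product'' in the paper) of $n+1$ copies of the complex field regarded as two-dimensional real algebras; it is a commutative, associative, unital real algebra of dimension $2^{n+1}$. A commutative, associative, unital real algebra of finite dimension $N$ is called polynomial if it contains an element $v$ such that $\{v^0,v,\ldots,v^{N-1}\}$ is a basis, i.e. if it is isomorphic to $\mathbb R[X]/(P)$ for some polynomial $P\in\mathbb R[X]$ of degree $N$ (a generating polynomial). *)

(* Defs.v *)
From HB Require Import structures.
From mathcomp Require Import all_boot all_order all_algebra all_field.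
From mathcomp Require Import complex reals.

Set Implicit Arguments.
Unset Strict Implicit.
Unset Printing Implicit Defensive.

Import GRing.Theory.
Local Open Scope ring_scope.

(* [Rcomplex R] is the type R[i] seen as an algebra over R (R[i] itself is
   scaled by complex numbers). *)
Section RealAlgebraOfComplexNumbers.
Variable R : rcfType.

Fact Rcomplex_scaleAr (k : R) (x y : Rcomplex R) : k *: (x * y) = x * (k *: y).
Proof.
case: x y => [a b] [c d]; apply/eqP; rewrite eq_complex /=.
by rewrite mulrBr mulrDr !mulrA ![_ * k]mulrC !eqxx.
Qed.

HB.instance Definition _ :=
  GRing.Lalgebra_isAlgebra.Build R (Rcomplex R) Rcomplex_scaleAr.

Fact Rcomplex_vect_iso : SemiVector.axiom 2 (Rcomplex R).
Proof.
exists (fun z : Rcomplex R => \row_(j < 2) (if j == 0 then Re z else Im z)).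
  split=> [k [a b]|[a b] [c d]]; apply/rowP=> j; rewrite !mxE /=;
    by case: ifP.
exists (fun r : 'rV[R]_2 => Complex (r 0 0) (r 0 1)) => [[a b]|r].
  by rewrite !mxE.
by apply/rowP=> j; rewrite mxE; case: j => [[|[|]]] //= j2;
  congr (r 0 _); apply: val_inj.
Qed.

HB.instance Definition _ :=
  LSemiModule_hasFinDim.Build R (Rcomplex R) Rcomplex_vect_iso.

End RealAlgebraOfComplexNumbers.

Section TensorProduct.
Variables (K : fieldType) (A B : falgType K).

(* An element of A \otimes B is given by its coordinates in the basis
   e_i \otimes f_j, where (e_i) and (f_j) are the bases [vbasis {:A}] of A and
   [vbasis {:B}] of B. *)
Definition tensor := 'M[K]_(\dim {:A}, \dim {:B}).

HB.instance Definition _ := Vector.copy tensor 'M[K]_(\dim {:A}, \dim {:B}).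

Definition pure_tensor (a : A) (b : B) : tensor :=
  \matrix_(i, j) (coord (vbasis {:A}) i a * coord (vbasis {:B}) j b).

Local Notation "a \ox b" := (pure_tensor a b)
  (at level 40, left associativity).

(* The linear map A \otimes B -> V sending e_i \otimes f_j to f e_i f_j. *)
Definition tensor_lift (V : lmodType K) (f : A -> B -> V) (t : tensor) : V :=
  \sum_i \sum_j t i j *: f (vbasis {:A})`_i (vbasis {:B})`_j.

Definition tensor_mul (s t : tensor) : tensor :=
  tensor_lift
    (fun a b => tensor_lift (fun c d => (a * c) \ox (b * d)) t) s.

Lemma tensor_lift_is_linear (V : lmodType K) (f : A -> B -> V) :
  linear (tensor_lift f).
Proof.
move=> k s t; rewrite /tensor_lift scaler_sumr -big_split; apply: eq_bigr => i _.
rewrite scaler_sumr -big_split; apply: eq_bigr => j _ /=.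
by rewrite !mxE scalerDl scalerA.
Qed.

HB.instance Definition _ (V : lmodType K) (f : A -> B -> V) :=
  GRing.isLinear.Build K tensor V _ (tensor_lift f) (tensor_lift_is_linear f).

Lemma pure_tensor_linearl b : linear (pure_tensor^~ b).
Proof. by move=> k u v; apply/matrixP=> i j; rewrite !mxE linearP mulrDl mulrA. Qed.

Lemma pure_tensor_linearr a : linear (pure_tensor a).
Proof.
by move=> k u v; apply/matrixP=> i j; rewrite !mxE linearP mulrDr mulrCA.
Qed.

(* The universal property of A \otimes B: a bilinear map f factors through
   [pure_tensor] as [tensor_lift f], and in no other way. *)
Lemma tensor_lift_pure (V : lmodType K) (f : A -> B -> V) a b :
  (forall b, linear (f^~ b)) -> (forall a, linear (f a)) ->
  tensor_lift f (a \ox b) = f a b.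
Proof.
move=> fl fr.
have fl0 c : f 0 c = 0.
  by have := fl c (-1) 0 0; rewrite scaler0 addr0 scaleN1r addNr.
have fr0 c : f c 0 = 0.
  by have := fr c (-1) 0 0; rewrite scaler0 addr0 scaleN1r addNr.
have fls c (I : finType) (k : I -> K) (v : I -> A) :
    f (\sum_i k i *: v i) c = \sum_i k i *: f (v i) c.
  pose F := fun x => f x c; rewrite -/(F _).
  by elim/big_rec2: _ => [|i x y _ <-]; [apply: fl0 | rewrite /F fl].
have frs c (I : finType) (k : I -> K) (v : I -> B) :
    f c (\sum_i k i *: v i) = \sum_i k i *: f c (v i).
  by elim/big_rec2: _ => [|i x y _ <-]; [apply: fr0 | rewrite fr].
rewrite {2}(coord_vbasis (memvf a)) {2}(coord_vbasis (memvf b)) fls.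
apply: eq_bigr => i _; rewrite frs scaler_sumr.
by apply: eq_bigr => j _; rewrite mxE scalerA.
Qed.

Lemma tensorE (t : tensor) :
  t = \sum_i \sum_j t i j *: ((vbasis {:A})`_i \ox (vbasis {:B})`_j).
Proof.
apply/matrixP=> k l; rewrite summxE (bigD1 k) //= summxE (bigD1 l) //=.
have fA := basis_free (vbasisP {:A}); have fB := basis_free (vbasisP {:B}).
rewrite !mxE !coord_free // !eqxx !mulr1 !big1 ?addr0 //.
  move=> i ik; rewrite summxE big1 // => j _.
  rewrite !mxE coord_free // (_ : (i == k) = false) ?mulr0n ?mul0r ?mulr0 //.
  exact: negPf ik.
move=> j jl.
rewrite !mxE !coord_free // (_ : (j == l) = false) ?mulr0n ?mulr0 //.
exact: negPf jl.
Qed.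

Lemma eq_tensor_linear (V : lmodType K) (f g : tensor -> V) :
  linear f -> linear g -> (forall a b, f (a \ox b) = g (a \ox b)) -> f =1 g.
Proof.
move=> fl gl fg t.
pose F : {linear tensor -> V} := HB.pack f (GRing.isLinear.Build K tensor V _ f fl).
pose G : {linear tensor -> V} := HB.pack g (GRing.isLinear.Build K tensor V _ g gl).
rewrite -[f]/(F : _ -> _) -[g]/(G : _ -> _) (tensorE t) !linear_sum.
apply: eq_bigr => i _; rewrite !linear_sum; apply: eq_bigr => j _.
by rewrite !linearZ; congr (_ *: _); apply: fg.
Qed.


Lemma eq_tensor_lift_linear (V : lmodType K) (f g h : A -> B -> V) k t :
    (forall a b, f a b = k *: g a b + h a b) ->
  tensor_lift f t = k *: tensor_lift g t + tensor_lift h t.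
Proof.
move=> fE; rewrite /tensor_lift scaler_sumr -big_split; apply: eq_bigr => i _.
rewrite scaler_sumr -big_split; apply: eq_bigr => j _ /=.
by rewrite fE scalerDr !scalerA mulrC.
Qed.

Lemma tensor_mul_linearl t : linear (tensor_mul^~ t).
Proof. exact: tensor_lift_is_linear. Qed.

Lemma tensor_mul_linearr s : linear (tensor_mul s).
Proof.
move=> k t u; apply: eq_tensor_lift_linear => a b.
exact: tensor_lift_is_linear.
Qed.

Lemma tensor_mul_pure a b c d :
  tensor_mul (a \ox b) (c \ox d) = (a * c) \ox (b * d).
Proof.
rewrite /tensor_mul tensor_lift_pure => [|y k u v|x k u v].
- rewrite tensor_lift_pure // => [y|x] k u v.
    by rewrite mulrDr -scalerAr pure_tensor_linearl.
  by rewrite mulrDr -scalerAr pure_tensor_linearr.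
- apply: eq_tensor_lift_linear => x z.
  by rewrite mulrDl -scalerAl pure_tensor_linearl.
- apply: eq_tensor_lift_linear => y z.
  by rewrite mulrDl -scalerAl pure_tensor_linearr.
Qed.

Fact tensor_mulA : associative tensor_mul.
Proof.
move=> s t u; move: s; apply: eq_tensor_linear => [||a b].
- by move=> k s s'; rewrite tensor_mul_linearl.
- by move=> k s s'; rewrite !tensor_mul_linearl.
move: t; apply: eq_tensor_linear => [||c d].
- by move=> k t t'; rewrite tensor_mul_linearl tensor_mul_linearr.
- by move=> k t t'; rewrite tensor_mul_linearr tensor_mul_linearl.
move: u; apply: eq_tensor_linear => [||e f].
- by move=> k u u'; rewrite !tensor_mul_linearr.
- by move=> k u u'; rewrite tensor_mul_linearr.
by rewrite !tensor_mul_pure !mulrA.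
Qed.

Fact tensor_mul1l : left_id (1 \ox 1) tensor_mul.
Proof.
apply: eq_tensor_linear => [||a b]; first exact: tensor_mul_linearr.
  by move=> k u v.
by rewrite tensor_mul_pure !mul1r.
Qed.

Fact tensor_mul1r : right_id (1 \ox 1) tensor_mul.
Proof.
apply: eq_tensor_linear => [||a b]; first exact: tensor_mul_linearl.
  by move=> k u v.
by rewrite tensor_mul_pure !mulr1.
Qed.

Fact tensor_mulDl : left_distributive tensor_mul +%R.
Proof.
by move=> s t u; have := tensor_mul_linearl u 1 s t; rewrite /= !scale1r.
Qed.

Fact tensor_mulDr : right_distributive tensor_mul +%R.
Proof.
by move=> s t u; have := tensor_mul_linearr s 1 t u; rewrite /= !scale1r.
Qed.

Fact tensor_1_neq0 : 1 \ox 1 != 0 :> tensor.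
Proof.
have nz (C : falgType K) : exists i, coord (vbasis {:C}) i 1 != 0.
  apply/existsP; apply: contraR (oner_neq0 C); rewrite negb_exists => /forallP c0.
  rewrite (coord_vbasis (memvf (1 : C))) big1 // => i _.
  by move: (c0 i); rewrite negbK => /eqP ->; rewrite scale0r.
have [[i ci] [j cj]] := (nz A, nz B).
apply: contraNneq (mulf_neq0 ci cj) => /matrixP/(_ i j).
by rewrite !mxE => ->.
Qed.

HB.instance Definition _ := GRing.Zmodule_isNzRing.Build tensor
  tensor_mulA tensor_mul1l tensor_mul1r tensor_mulDl tensor_mulDr tensor_1_neq0.

Fact tensor_scaleAl (k : K) (s t : tensor) : k *: (s * t) = (k *: s) * t.
Proof.
rewrite -[RHS]/(tensor_mul (k *: s) t) -[k *: s]addr0 tensor_mul_linearl.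
by rewrite -[tensor_mul 0 t]/(0 * t) mul0r addr0.
Qed.

HB.instance Definition _ :=
  GRing.Lmodule_isLalgebra.Build K tensor tensor_scaleAl.

Fact tensor_scaleAr (k : K) (s t : tensor) : k *: (s * t) = s * (k *: t).
Proof.
rewrite -[RHS]/(tensor_mul s (k *: t)) -[k *: t]addr0 tensor_mul_linearr.
by rewrite -[tensor_mul s 0]/(s * 0) mulr0 addr0.
Qed.

HB.instance Definition _ :=
  GRing.Lalgebra_isAlgebra.Build K tensor tensor_scaleAr.

HB.instance Definition _ := Algebra_isFalgebra.Build K tensor.

Lemma mul_pure_tensor a b c d :
  (a \ox b) * (c \ox d) = (a * c) \ox (b * d).
Proof. exact: tensor_mul_pure. Qed.

Lemma tensor_mulC :
  commutative (@GRing.mul A) -> commutative (@GRing.mul B) ->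
  commutative (@GRing.mul tensor).
Proof.
move=> AC BC s t; move: s; apply: eq_tensor_linear => [||a b].
- exact: tensor_mul_linearl.
- exact: tensor_mul_linearr.
move: t; apply: eq_tensor_linear => [||c d].
- exact: tensor_mul_linearr.
- exact: tensor_mul_linearl.
by rewrite !mul_pure_tensor AC BC.
Qed.

Lemma dim_tensor : \dim {:tensor} = (\dim {:A} * \dim {:B})%N.
Proof. by rewrite dimvf. Qed.

End TensorProduct.

(* C_0 \otimes C_1 \otimes ... \otimes C_n, with n.+1 factors. *)
Fixpoint Ctensor (R : rcfType) (n : nat) : falgType R :=
  if n is m.+1 then tensor (Ctensor R m) (Rcomplex R) else Rcomplex R.

Lemma dim_Ctensor (R : rcfType) n : \dim {:Ctensor R n} = (2 ^ n.+1)%N.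
Proof.
elim: n => [|n IHn]; first by rewrite dimvf.
by rewrite [LHS]dim_tensor IHn dimvf [in RHS]expnSr.
Qed.

Lemma Ctensor_mulC (R : rcfType) n : commutative (@GRing.mul (Ctensor R n)).
Proof. by elim: n => [|n IHn]; [|apply: tensor_mulC => //]; apply: mulrC. Qed.

Section FalgebraProperties.
Variables (K : fieldType) (A : falgType K).

Definition falg_isomorphic (B : falgType K) : Prop :=
  exists f : {lrmorphism A -> B}, bijective f.

(* A is the internal direct sum of the algebras U k, each of which has
   its own identity [algid (U k)], in general different from that of A. *)
Definition direct_sum_of_subalgebras m (U : 'I_m -> {aspace A}) : Prop :=
  [/\ (\sum_k U k)%VS = {:A}%VS, directv (\sum_k U k)
    & forall j k, j != k -> (U j * U k)%VS = 0%VS].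

Definition polynomial_algebra : Prop :=
  exists v : A, basis_of {:A} [seq v ^+ i | i <- iota 0 (\dim {:A})].

Definition left_ideal (U : {vspace A}) : Prop := ({:A} * U <= U)%VS.

Definition simple_left_ideal (U : {vspace A}) : Prop :=
  [/\ left_ideal U, U != 0%VS
    & forall V, left_ideal V -> (V <= U)%VS -> V = 0%VS \/ V = U].

(* The left A-module A is a direct sum of simple submodules; the left
   A-submodules of A are its left ideals. *)
Definition semisimple_algebra : Prop :=
  exists (m : nat) (U : 'I_m -> {vspace A}),
    [/\ forall k, simple_left_ideal (U k), (\sum_k U k)%VS = {:A}%VS
      & directv (\sum_k U k)].

End FalgebraProperties.

(* Main.v *)
From HB Require Import structures.
Require Import Defs.
From mathcomp Require Import all_boot all_order all_algebra all_field.
From mathcomp Require Import complex reals.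

(** The map [a + b i |-> (a + b J) e], where [e] is a nonzero idempotent and [J]
    a square root of -1 that commutes with it, embeds the complex field in a real
    algebra as a subalgebra with identity [e].  The tensor power with [n.+1]
    factors contains [2 ^ n] such copies of the complex field that annihilate
    each other; they are independent, hence span a subspace of dimension
    [2 ^ n * 2], and this is the dimension of the whole algebra.

    The copies come from the isomorphism between the tensor square of the complex
    field and the product of two complex fields.  In [Ctensor R n.+1], the
    element [u := J \otimes i] satisfies [u ^ 2 = 1], so that [(1 + u) / 2] and
    [(1 - u) / 2] are orthogonal idempotents and each copy in [Ctensor R n]
    yields two copies in [Ctensor R n.+1].  The map [Cblock n s] is the resulting
    embedding, where the binary digits of [s] record the choices of sign; see
    [CblockM], [Cblock_orth] and [Cblock1_neq0].

    The three conclusions hold in every algebra with such a system of copies.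
    It is the direct sum of the copies ([block_direct_sum]), and each copy is a
    left ideal, simple because it is a field ([block_simple]).  It is generated
    by the element [v] whose component in copy [k] is [k + i]: a nonzero
    real polynomial of degree less than the dimension that kills [v] would have
    more roots, the numbers [k + i] and [k - i], than its degree allows
    ([block_polynomial]). *)

Set Implicit Arguments.
Unset Strict Implicit.
Unset Printing Implicit Defensive.

Import Order.TTheory GRing.Theory Num.Theory.
Local Open Scope ring_scope.

(** * Algebras that contain enough orthogonal copies of the complex field *)

Section ComplexBlocks.
Variables (R : rcfType) (A : falgType R) (m : nat).
Variable g : 'I_m -> {linear Rcomplex R -> A}.
Hypothesis gM : forall k z w, g k (z * w) = g k z * g k w.
Hypothesis g_orth : forall j k z w, j != k -> g j z * g k w = 0.
Hypothesis g1_neq0 : forall k, g k 1 != 0.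
Hypothesis dimA : \dim {:A} = (m * 2)%N.

(** A multiplicative map out of a field that does not kill 1 is injective. *)
Lemma block_eq0 k z : (g k z == 0) = (z == 0).
Proof.
apply/eqP/eqP => [gz0 | ->]; last exact: linear0.
apply/eqP; apply: contraNT (g1_neq0 k) => nz_z.
by rewrite -(mulVf nz_z) gM gz0 mulr0.
Qed.

Lemma block_inj k : injective (g k).
Proof.
by move=> z w /eqP; rewrite -subr_eq0 -linearB block_eq0 subr_eq0 => /eqP.
Qed.

Definition block k : {vspace A} := limg (linfun (g k)).

Lemma memv_blockP k x : reflect (exists z, x = g k z) (x \in block k).
Proof.
apply: (iffP memv_imgP) => [[z _ ->]|[z ->]]; exists z; rewrite ?lfunE //.
exact: memvf.
Qed.

Lemma memv_block k z : g k z \in block k.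
Proof. by apply/memv_blockP; exists z. Qed.

Lemma dim_block k : \dim (block k) = 2.
Proof.
rewrite limg_dim_eq ?dimvf //; apply/eqP; rewrite -subv0; apply/subvP=> z.
by rewrite memv_cap memv_ker lfunE memv0 /= block_eq0 => /andP[].
Qed.

Lemma block_algid k : is_algid (g k 1) (block k).
Proof.
split; [exact: memv_block | exact: g1_neq0 | move=> _ /memv_blockP[z ->]].
by rewrite -!gM mul1r mulr1.
Qed.

Lemma block_is_aspace k : is_aspace (block k).
Proof.
apply/andP; split.
  by apply/has_algidP; exists (g k 1); apply: block_algid.
apply/prodvP=> _ _ /memv_blockP[z ->] /memv_blockP[w ->].
by rewrite -gM memv_block.
Qed.

Definition block_aspace k : {aspace A} := ASpace (block_is_aspace k).

Lemma algid_block k : algid (block_aspace k) = g k 1.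
Proof.
have [_ _ /(_ _ (memv_algid (block_aspace k)))[]] := block_algid k.
by rewrite (@algidr _ _ (block_aspace k) _ (memv_block k 1)).
Qed.

(** A vanishing sum of block elements, multiplied by the identity of one block,
    leaves the component in that block. *)
Lemma directv_block : directv (\sum_k block k).
Proof.
apply/directv_sum_independent => us us_in us0 k _.
have /memv_blockP[z uk] := us_in k isT.
have := congr1 ( *%R (g k 1)) us0; rewrite mulr0 mulr_sumr (bigD1 k) //=.
rewrite uk -gM mul1r big1 ?addr0 // => j jk.
by have /memv_blockP[w ->] := us_in j isT; rewrite g_orth // eq_sym.
Qed.

(** The direct sum has dimension twice the number of blocks, which is all of
    the dimension available. *)
Lemma sum_block : (\sum_k block k)%VS = {:A}%VS.
Proof.
apply/eqP; rewrite eqEdim subvf dimA (directvP directv_block) /=.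
rewrite (eq_bigr (fun=> 2)) ?sum_nat_const ?card_ord // => k _.
exact: dim_block.
Qed.

Lemma block_direct_sum : direct_sum_of_subalgebras block_aspace.
Proof.
split; [exact: sum_block | exact: directv_block | move=> j k jk].
apply/eqP; rewrite -subv0.
apply/prodvP=> _ _ /memv_blockP[z ->] /memv_blockP[w ->].
by rewrite g_orth // mem0v.
Qed.

(** The embedding itself, seen as a map onto the block, is inverse to the
    isomorphism. *)
Lemma block_isomorphic k :
  falg_isomorphic (subvs_of (block_aspace k)) (Rcomplex R).
Proof.
pose h z : subvs_of (block_aspace k) := Subvs (memv_block k z).
have h_lin : linear h by move=> a z w; apply: val_inj; rewrite /= linearP.
have hM : monoid_morphism h.
  by split=> [|z w]; apply: val_inj; rewrite /= ?algid_block ?gM.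
have [f hf fh] : bijective h.
  have hP (x : subvs_of (block_aspace k)) : exists z, val x == g k z.
    by have /memv_blockP[z zP] := subvsP x; exists z; apply/eqP.
  exists (fun x => xchoose (hP x)) => [z|x].
    by apply: (@block_inj k); rewrite -(eqP (xchooseP (hP (h z)))).
  by apply: val_inj; rewrite /= -(eqP (xchooseP (hP x))).
pose H : {lrmorphism Rcomplex R -> subvs_of (block_aspace k)} :=
  HB.pack h (GRing.isLinear.Build _ _ _ _ h h_lin)
    (GRing.isMonoidMorphism.Build _ _ h hM).
pose F : {lrmorphism subvs_of (block_aspace k) -> Rcomplex R} :=
  HB.pack f
    (GRing.isLinear.Build _ _ _ _ f
       (can2_linear (f := H) hf fh))
    (GRing.isMonoidMorphism.Build _ _ f
       (can2_monoid_morphism (f := H) hf fh)).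
by exists F; exists h.
Qed.

Lemma block_left_ideal k : left_ideal (block k).
Proof.
rewrite /left_ideal -sum_block; apply/prodvP=> x y /memv_sumP[us us_in ->].
case/memv_blockP=> z ->; rewrite mulr_suml; apply: memv_suml => j _.
have /memv_blockP[w ->] := us_in j isT.
have [->|jk] := eqVneq j k; first by rewrite -gM memv_block.
by rewrite g_orth ?mem0v.
Qed.

(** A nonzero element of a block is invertible within the block, hence generates
    it as a left ideal. *)
Lemma block_simple k : simple_left_ideal (block k).
Proof.
split; first exact: block_left_ideal.
  by apply: contraNneq (g1_neq0 k) => U0; rewrite -memv0 -U0 memv_block.
move=> V idV sVU; have [->|nzV] := eqVneq V 0%VS; [by left | right].
apply/eqP; rewrite eqEsubv sVU; apply/subvP=> _ /memv_blockP[w ->].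
have /memv_blockP[z Dz] := subvP sVU _ (memv_pick V).
have nz_z : z != 0 by rewrite -(block_eq0 k) -Dz vpick0.
rewrite -(divfK nz_z w) gM -Dz; apply: (subvP idV).
by rewrite memv_mul ?memvf ?memv_pick.
Qed.

Lemma block_semisimple : semisimple_algebra A.
Proof.
exists m, block; split; [exact: block_simple | exact: sum_block |].
exact: directv_block.
Qed.

(** The real parts are distinct and the imaginary parts positive, so these
    numbers and their conjugates are pairwise distinct. *)
Definition node (k : 'I_m) : Rcomplex R := Complex k%:R 1.

Definition generator : A := \sum_k g k (node k).

(** Powers of the generator are computed inside each block, including power 0,
    since the identity of the block appears as a factor. *)
Lemma generatorX k i : generator ^+ i * g k 1 = g k (node k ^+ i).
Proof.
elim: i => [|i IHi]; first by rewrite !expr0 mul1r.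
rewrite exprS -mulrA IHi /generator mulr_suml (bigD1 k) //= -gM -exprS.
by rewrite big1 ?addr0 // => j jk; rewrite g_orth.
Qed.

(** A linear relation between the first [m * 2] powers of the generator is a
    real polynomial; multiplied by the identity of block [k], it shows that
    [k + i] is a root, and [k - i] is then a root as well.  That makes [m * 2]
    distinct roots for a polynomial of degree less than [m * 2]. *)
Lemma block_polynomial : polynomial_algebra A.
Proof.
exists generator; rewrite basisEfree subvf size_map size_iota leqnn !andbT.
have szT : size [seq generator ^+ i | i <- iota 0 (\dim {:A})] == (m * 2)%N.
  by rewrite size_map size_iota dimA.
pose X := Tuple szT.
suff: free X by []; apply/(@freeP _ _ _ X) => c c0 i /=.
(* [insub] extends the coefficients [c], indexed by ordinals, to [nat]. *)
pose P := \poly_(j < m * 2) (if insub j is Some j' then c j' else 0).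
pose PC : {poly R[i]} := map_poly (real_complex R) P.
have szP : (size PC <= m * 2)%N by rewrite size_map_poly size_poly.
have Pk k : root PC (node k).
  have := congr1 ( *%R^~ (g k 1)) c0; rewrite mul0r mulr_suml.
  under eq_bigr => j _.
    rewrite /= (nth_map 0%N) ?size_iota ?dimA ?ltn_ord // nth_iota ?dimA //.
    rewrite -scalerAl generatorX -linearZ; over.
  rewrite -linear_sum => /eqP; rewrite block_eq0 => /eqP P0.
  rewrite /root (horner_coef_wide _ szP) -[X in _ == X]P0; apply/eqP.
  apply: eq_bigr => j _; rewrite coef_map coef_poly ltn_ord valK.
  (* Real scaling of [Rcomplex R] against multiplication by a real of [R[i]]. *)
  rewrite add0n; case: (node k ^+ j) => a b; apply/eqP.
  by rewrite eq_complex /= !mul0r subr0 addr0 !eqxx.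
have PconjC : map_poly conjc PC = PC.
  by rewrite -map_poly_comp; apply: eq_map_poly => x /=; rewrite oppr0.
have Pconj k : root PC (conjc (node k)).
  by rewrite -complex_root_conj PconjC; apply: Pk.
pose rs : seq R[i] :=
  [seq node k | k <- enum 'I_m] ++ [seq conjc (node k) | k <- enum 'I_m].
have rs_roots : all (root PC) rs.
  rewrite all_cat !all_map; apply/andP.
  by split; apply/allP=> k _; [apply: Pk | apply: Pconj].
have node_inj : injective node.
  by move=> j k [/eqP]; rewrite eqr_nat => /eqP/val_inj.
have rs_uniq : uniq rs.
  have conj_inj := inj_comp (can_inj (@conjcK R)) node_inj.
  rewrite cat_uniq (map_inj_uniq node_inj) (map_inj_uniq conj_inj).
  rewrite enum_uniq andbT.
  apply/hasPn=> _ /mapP[k _ ->]; apply/mapP=> -[j _ [_ /eqP]].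
  by rewrite lt_eqF // (lt_trans _ ltr01) // oppr_lt0 ltr01.
have PC0 : PC = 0.
  apply: contraTeq szP => nzPC; rewrite -ltnNge.
  have := max_poly_roots nzPC rs_roots rs_uniq.
  have sz_map (f : 'I_m -> R[i]) : size [seq f k | k <- enum 'I_m] = m.
    by rewrite (size_map f) size_enum_ord.
  by rewrite size_cat !sz_map addnn muln2.
have P0 : P = 0.
  by apply: (map_poly_inj (real_complex R)); rewrite -/PC PC0 rmorph0.
by have := congr1 (coefp i) P0; rewrite /= coef_poly ltn_ord valK coef0.
Qed.

End ComplexBlocks.

(** * Complex blocks of a tensor power of the complex field *)

Section PureTensors.
Variables (K : fieldType) (A B : falgType K).
Implicit Types (a c : A) (b : B).

Lemma pure_tensorDl a c b :
  pure_tensor (a + c) b = pure_tensor a b + pure_tensor c b.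
Proof. by apply/matrixP=> i j; rewrite !mxE linearD mulrDl. Qed.

Lemma pure_tensorZl k a b : pure_tensor (k *: a) b = k *: pure_tensor a b.
Proof. by apply/matrixP=> i j; rewrite !mxE linearZ mulrA. Qed.

Lemma pure_tensorNr a b : pure_tensor a (- b) = - pure_tensor a b.
Proof. by apply/matrixP=> i j; rewrite !mxE linearN mulrN. Qed.

Lemma pure_tensor0l b : pure_tensor (0 : A) b = 0.
Proof. by apply/matrixP=> i j; rewrite !mxE linear0 mul0r. Qed.

End PureTensors.

Section TensorPower.
Variable R : rcfType.

Local Notation I := ('i%C : Rcomplex R).

(** With [e] and [J] the idempotent and the square root of -1 behind
    [Cblock m s./2], the value at [a + b i] is the product of
    [((a + b J) e) \otimes 1] with [(1 + u) / 2] if [s] is even and with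
    [(1 - u) / 2] if [s] is odd, where [u = J \otimes i]. *)
Fixpoint Cblock n (s : nat) : Rcomplex R -> Ctensor R n :=
  match n return Rcomplex R -> Ctensor R n with
  | 0 => id
  | m.+1 => fun z =>
      2%:R^-1 *: (pure_tensor (Cblock m s./2 z) 1
                  + (-1) ^+ odd s *: pure_tensor (Cblock m s./2 (I * z)) I)
  end.

Lemma Cblock_linear n s : linear (Cblock n s).
Proof.
elim: n s => [|n IHn] s k z w //=.
rewrite mulrDr -scalerAr !IHn !pure_tensorDl !pure_tensorZl.
rewrite !scalerDr !scalerA [k / 2%:R]mulrC [_ * k * _]mulrAC.
by rewrite addrACA.
Qed.

HB.instance Definition _ n s :=
  GRing.isLinear.Build R (Rcomplex R) (Ctensor R n) _ (Cblock n s)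
    (Cblock_linear n s).

Lemma sqrI : I * I = -1.
Proof.
apply/eqP; rewrite eq_complex /=.
by rewrite !(mul0r, mulr0, mul1r, sub0r, addr0, oppr0) !eqxx.
Qed.

Lemma mulII z w : I * z * (I * w) = - (z * w).
Proof. by rewrite mulrACA sqrI mulN1r. Qed.

(** The two specializations of interest are [s = t], where the two terms under
    each tensor agree and add up, and [s./2 = t./2] with [s] and [t] of
    different parity, where they cancel. *)
Lemma CblockS_mul n s t z w :
  Cblock n.+1 s z * Cblock n.+1 t w =
  4%:R^-1 *:
    (pure_tensor
       (Cblock n s./2 z * Cblock n t./2 w
        - (-1) ^+ (odd s (+) odd t)
            *: (Cblock n s./2 (I * z) * Cblock n t./2 (I * w))) 1
     + pure_tensor
         ((-1) ^+ odd t *: (Cblock n s./2 z * Cblock n t./2 (I * w))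
          + (-1) ^+ odd s *: (Cblock n s./2 (I * z) * Cblock n t./2 w)) I).
Proof.
rewrite /= -scalerAl -scalerAr scalerA -invfM -natrM; congr (_ *: _).
rewrite mulrDl !mulrDr -!scalerAl -!scalerAr !mul_pure_tensor mul1r mulr1 sqrI.
rewrite mul1r pure_tensorNr signr_addb -scaleNr !pure_tensorDl !pure_tensorZl.
by rewrite !scalerN !scaleNr scalerA [X in _ + _ + X]addrC addrACA.
Qed.

Lemma CblockM n s z w : Cblock n s (z * w) = Cblock n s z * Cblock n s w.
Proof.
elim: n s z w => [|n IHn] s z w //; rewrite CblockS_mul addbb scale1r -!IHn.
rewrite mulII linearN opprK !(mulrCA z) !mulrA -!mulrA -!scalerDr -!mulr2n.
rewrite -!scaler_nat !pure_tensorZl scalerA [_ * 2%:R]mulrC.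
rewrite -scalerA -scalerDr scalerA.
by rewrite (natrM _ 2 2) invfM -mulrA mulVf ?mulr1 ?pnatr_eq0.
Qed.

Lemma Cblock_orth n s t z w :
  (s < 2 ^ n)%N -> (t < 2 ^ n)%N -> s != t -> Cblock n s z * Cblock n t w = 0.
Proof.
elim: n s t z w => [|n IHn] s t z w.
  by rewrite !ltnS !leqn0 => /eqP-> /eqP->.
move=> ltsn lttn st; rewrite CblockS_mul.
have half_lt r : (r < 2 ^ n.+1)%N -> (r./2 < 2 ^ n)%N.
  by rewrite -divn2 ltn_divLR // -expnSr.
have [eq_half | neq_half] := eqVneq s./2 t./2; last first.
  by rewrite !IHn ?half_lt // !scaler0 subr0 addr0 !pure_tensor0l addr0 scaler0.
have odd_st : odd s (+) odd t.
  rewrite -negb_eqb; apply: contraNN st => /eqP eq_odd; apply/eqP.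
  by rewrite -[s]odd_double_half -[t]odd_double_half eq_half eq_odd.
rewrite eq_half odd_st -!CblockM mulII mulrCA !mulrA expr1 scaleN1r opprK.
rewrite linearN subrr -scalerDl.
have -> : (-1) ^+ odd t + (-1) ^+ odd s = 0 :> R.
  case: (odd s) (odd t) odd_st => [] [] // _;
    by rewrite expr0 expr1 ?subrr ?addNr.
by rewrite scale0r !pure_tensor0l addr0 scaler0.
Qed.

(** By the universal property, [x \otimes y |-> Re y *: x] is linear. *)
Lemma real_part_eq0 (A : falgType R) (a b : A) :
  pure_tensor a (1 : Rcomplex R) + pure_tensor b I = 0 -> a = 0.
Proof.
pose re_right (x : A) (y : Rcomplex R) : A := complex.Re y *: x.
have reE x y : tensor_lift re_right (pure_tensor x y) = complex.Re y *: x.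
  rewrite tensor_lift_pure // => [c|c] k u v; rewrite /re_right.
    by rewrite scalerDr !scalerA mulrC.
  by rewrite linearP scalerDl scalerA.
move/(congr1 (tensor_lift re_right)); rewrite linearD linear0 /= !reE.
by rewrite /= scale1r scale0r addr0.
Qed.

Lemma Cblock1_neq0 n s : Cblock n s 1 != 0.
Proof.
elim: n s => [|n IHn] s; first exact: oner_neq0.
apply: contraNneq (IHn s./2) => /= /eqP.
rewrite scaler_eq0 invr_eq0 pnatr_eq0 /= -pure_tensorZl => /eqP.
by move/real_part_eq0 => ->.
Qed.

End TensorPower.

Theorem mainTheorem2 (R : realType) (n : nat) :
  (exists U : 'I_(2 ^ n) -> {aspace (Ctensor R n)},
     direct_sum_of_subalgebras U /\
     (forall k, falg_isomorphic (subvs_of (U k)) (Rcomplex R))) /\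
  polynomial_algebra (Ctensor R n) /\
  semisimple_algebra (Ctensor R n).
Proof.
pose g (k : 'I_(2 ^ n)) : {linear Rcomplex R -> Ctensor R n} := Cblock n k.
have gM k z w : g k (z * w) = g k z * g k w by apply: CblockM.
have gO j k z w : j != k -> g j z * g k w = 0.
  by move=> jk; apply: Cblock_orth.
have g1 k : g k 1 != 0 by apply: Cblock1_neq0.
have dimA : \dim {:Ctensor R n} = (2 ^ n * 2)%N by rewrite dim_Ctensor expnSr.
split; last first.
  split; first exact: block_polynomial gM gO g1 dimA.
  exact: block_semisimple gM gO g1 dimA.
exists (block_aspace gM g1); split; first exact: block_direct_sum.
exact: block_isomorphic.
Qed.
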